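(* Let $p=\bigoplus_{i=1}^{m}n_i\delta^{t_i}$ and $p'=\bigoplus_{j=1}^{m'}n'_j\delta^{t'_j}$ be polynomials. Then $$p\odot p'=\bigoplus_{i=1}^{m}\bigoplus_{j=1}^{m'}\left(n_i\delta^{t_i}\odot n'_j\delta^{t'_j}\right).$$
   Context: Let $\overline{\mathbb Z}=\mathbb Z\cup\{-\infty,+\infty\}$ with its standard order. A counter is a map $s:\overline{\mathbb Z}\to\overline{\mathbb Z}$ that is non-decreasing for the standard order and satisfies $s(-\infty)=-\infty$, $s(+\infty)=+\infty$; $\Sigma$ is the set of counters. Thus a counter is determined by its values on $\mathbb Z$. For counters, $s\oplus s'$ is the counter with $(s\oplus s')(t)=\min(s(t),s'(t))$ (standard minimum) for all $t\in\mathbb Z$. The Hadamard product of $s_1,s_2\in\Sigma$ is the counter $s_1\odot s_2$ with $(s_1\odot s_2)(t)=s_1(t)+s_2(t)$ for all $t\in\mathbb Z$, where $(+\infty)+(-\infty)=+\infty$. For $n,t_0\in\overline{\mathbb Z}$, the monomial $n\delta^{t_0}$ denotes the counter with value $n$ at every $t\in\mathbb Z$ with $t\le t_0$, and value $+\infty$ at every $t\in\mathbb Z$ with $t>t_0$. A polynomial is a counter written as a finite sum $\bigoplus_{i=1}^{m}n_i\delta^{t_i}$ of monomials, $m\ge 1$, with $n_i<n_{i+1}$ and $t_i<t_{i+1}$ (standard order). *)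

(* Defs.v *)
From HB Require Import structures.
From mathcomp Require Import all_boot all_order all_algebra.
From mathcomp Require Import boolp constructive_ereal.

Set Implicit Arguments.
Unset Strict Implicit.
Unset Printing Implicit Defensive.

Import Order.TTheory GRing.Theory Num.Theory.

Local Open Scope ring_scope.
Local Open Scope ereal_scope.

Notation Zbar := (\bar int).

Definition is_counter (s : Zbar -> Zbar) : Prop :=
  [/\ {homo s : x y / x <= y}, s -oo = -oo & s +oo = +oo].

Record counter := Counter {
  counter_fun :> Zbar -> Zbar;
  counterP : is_counter counter_fun }.

Lemma counter_eq (s s' : counter) : (forall t : int, s t%:E = s' t%:E) -> s = s'.
Proof.
case: s s' => [f hf] [g hg] /= fg.
have E : f = g.
  by apply/funext => -[t||]; [exact: fg | case: hf hg => ? ? -> [] |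
     case: hf hg => ? -> ? []].
by subst g; congr Counter; exact: Prop_irrelevance.
Qed.

(* The counter determined by its values on the finite integers. *)
Definition extend (f : int -> Zbar) (x : Zbar) : Zbar :=
  match x with t%:E => f t | +oo => +oo | -oo => -oo end.

Lemma extend_is_counter (f : int -> Zbar) :
  {homo f : x y / (x <= y)%R >-> x <= y} -> is_counter (extend f).
Proof.
move=> hf; split=> // -[x||] [y||] //=; rewrite ?leey ?leNye //.
by rewrite lee_fin => /hf.
Qed.

Lemma counter_homo (s : counter) :
  {homo (fun t : int => s t%:E) : x y / (x <= y)%R >-> x <= y}.
Proof. by move=> x y xy; have [+ _ _] := counterP s; apply; rewrite lee_fin. Qed.

Lemma oplus_homo (s s' : counter) :
  {homo (fun t : int => Order.min (s t%:E) (s' t%:E)) :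
    x y / (x <= y)%R >-> x <= y}.
Proof. by move=> x y xy; rewrite le_min2 //; exact: counter_homo. Qed.

Definition oplus (s s' : counter) : counter :=
  Counter (@extend_is_counter (fun t => Order.min (s t%:E) (s' t%:E))
             (@oplus_homo s s')).

(* [+%dE] is the addition of [\bar int] for which +oo + -oo = +oo. *)
Lemma hadamard_homo (s s' : counter) :
  {homo (fun t : int => (s t%:E + s' t%:E)%dE) :
    x y / (x <= y)%R >-> x <= y}.
Proof. by move=> x y xy; apply: DualAddTheoryRealDomain.lee_dD; exact: counter_homo. Qed.

Definition hadamard (s s' : counter) : counter :=
  Counter (@extend_is_counter (fun t => (s t%:E + s' t%:E)%dE)
             (@hadamard_homo s s')).

Lemma monomial_homo (n t0 : Zbar) :
  {homo (fun t : int => if t%:E <= t0 then n else +oo) :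
    x y / (x <= y)%R >-> x <= y}.
Proof.
move=> x y xy /=; case: (leP y%:E t0) => [yt|_]; last by rewrite leey.
by rewrite (le_trans _ yt) // lee_fin.
Qed.

Definition monomial (n t0 : Zbar) : counter :=
  Counter (@extend_is_counter (fun t => if t%:E <= t0 then n else +oo)
             (@monomial_homo n t0)).

(* The counter equal to +oo on all finite integers, neutral for [oplus]. *)
Definition eps : counter := monomial +oo +oo.

Lemma oplusA : associative oplus.
Proof. by move=> a b c; apply: counter_eq => t /=; rewrite minA. Qed.

Lemma oplusC : commutative oplus.
Proof. by move=> a b; apply: counter_eq => t /=; rewrite minC. Qed.

Lemma oplus0s : left_id eps oplus.
Proof.
by move=> a; apply: counter_eq => t /=; rewrite leey min_r // leey.
Qed.

HB.instance Definition _ :=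
  Monoid.isComLaw.Build counter eps oplus oplusA oplusC oplus0s.

Notation "s (.) s'" := (hadamard s s') (at level 40, left associativity).
Notation "\bigoplus_ ( i < n ) F" := (\big[oplus/eps]_(i < n) F)
  (at level 41, F at level 41, i, n at level 50,
   format "'[' \bigoplus_ ( i  <  n ) '/  '  F ']'").

Definition is_polynomial (m : nat) (n t : 'I_m -> Zbar) (p : counter) : Prop :=
  [/\ (0 < m)%N,
      forall i j : 'I_m, j = i.+1 :> nat -> n i < n j,
      forall i j : 'I_m, j = i.+1 :> nat -> t i < t j &
      p = \bigoplus_(i < m) monomial (n i) (t i)].

(* Main.v *)
Require Import Defs.
From mathcomp Require Import all_boot all_order all_algebra.
From mathcomp Require Import constructive_ereal.

Import Order.TTheory.

(** Adding a constant is monotone on the totally ordered [\bar int], hence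
commutes with [min], so the product expands over finite sums; the empty sum
[eps] is absorbing because here [+oo + -oo = +oo]. *)

Lemma hadamardC : commutative hadamard.
Proof.
by move=> a b; apply: counter_eq => t; exact: DualAddTheoryNumDomain.daddeC.
Qed.

Lemma hadamard_eps : right_zero eps hadamard.
Proof. by move=> a; apply: counter_eq => u /=; rewrite leey; case: (a _). Qed.

Lemma hadamardDr : right_distributive hadamard oplus.
Proof.
move=> a b c; apply: counter_eq => u /=.
have addl_homo x y : (x <= y)%O -> (a u%:E + x <= a u%:E + y)%dE.
  by move=> xy; apply: DualAddTheoryRealDomain.lee_dD.
(* In either order of [b] and [c], both minima select the same term. The strict case is weakened by
   [ltW], since adding an infinite value can turn [<] into equality. *)
case: (leP (b u%:E) (c u%:E)) => [/addl_homo/min_l->|/ltW/addl_homo/min_r->] //.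
Qed.

Theorem proposition3p2 (m m' : nat) (n t : 'I_m -> Zbar) (n' t' : 'I_m' -> Zbar)
    (p p' : counter)
    (hp : is_polynomial n t p) (hp' : is_polynomial n' t' p') :
  p (.) p' =
  \bigoplus_(i < m) \bigoplus_(j < m')
     (monomial (n i) (t i) (.) monomial (n' j) (t' j)).
Proof.
have [_ _ _ ->] := hp; have [_ _ _ ->] := hp'.
(* Distributivity acts on the right factor only, so the sum for [p] is moved there and expanded
   first. *)
rewrite hadamardC (big_morph _ (hadamardDr _) (hadamard_eps _)).
apply: eq_bigr => i _.
(* Swapping back puts the sum for [p'] on the right and restores the order of the factors. *)
by rewrite hadamardC (big_morph _ (hadamardDr _) (hadamard_eps _)).
Qed.
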